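(* Let $\alpha,\beta$ be generators, let $\mathbb C(N)$ be the associated field of $\ast$-complex numbers, let $\mathbb A$ and $\mathbb B$ be $\ast_N$-algebras, and let $\varphi_N:\mathbb A\to\mathbb B$ be a $\ast_N$-homomorphism. Then $\varphi_N(\mathbb A)$ is a $\ast_N$-subalgebra of $\mathbb B$.
   Context: A generator is an injective function $\mathbb R\to\mathbb R$. For generators $\alpha,\beta$, write $\dot a=\alpha(a)$, $\ddot b=\beta(b)$ for $a,b\in\mathbb R$. $\mathbb C(N)=\{(\dot a,\ddot b):a,b\in\mathbb R\}$ is a field under $(\dot a_1,\ddot b_1)\oplus(\dot a_2,\ddot b_2)=(\alpha(a_1+a_2),\beta(b_1+b_2))$ and $(\dot a_1,\ddot b_1)\odot(\dot a_2,\ddot b_2)=(\alpha(a_1a_2-b_1b_2),\beta(a_1b_2+b_1a_2))$, with conjugation $\overline{(\dot a,\ddot b)}=(\dot a,\beta(-b))$. A $\mathbb C(N)$-algebra is a vector space $\mathbb A$ over the field $\mathbb C(N)$ (operations $\widehat+,\widehat\cdot$, zero $0_{\mathbb A}^N$) with an associative multiplication $\widehat\times$, distributive over $\widehat+$ on both sides, such that $\lambda\widehat\cdot(x\widehat\times y)=x\widehat\times(\lambda\widehat\cdot y)=(\lambda\widehat\cdot x)\widehat\times y$. A $\ast_N$-algebra is a $\mathbb C(N)$-algebra with an $N$-involution, i.e. a map $x\mapsto x^{\ast_N}$ with $(x\widehat+y)^{\ast_N}=x^{\ast_N}\widehat+y^{\ast_N}$, $(\lambda\widehat\cdot x)^{\ast_N}=\overline\lambda\,\widehat\cdot\,x^{\ast_N}$,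 $(x\widehat\times y)^{\ast_N}=y^{\ast_N}\widehat\times x^{\ast_N}$, $(x^{\ast_N})^{\ast_N}=x$. A $\mathbb C(N)$-algebra homomorphism is a map $\varphi_N:\mathbb A\to\mathbb B$ that is $\mathbb C(N)$-linear (it sends $x\widehat+\lambda\widehat\cdot y$ to the sum of $\varphi_N(x)$ and $\lambda$ times $\varphi_N(y)$ in $\mathbb B$) and multiplicative. It is a $\ast_N$-homomorphism if moreover $\varphi_N(x^{\ast_N})=\varphi_N(x)^{\ast_N}$ for all $x$. An $N$-subalgebra is a subset containing zero and closed under addition, scalar multiplication and multiplication. A $\ast_N$-subalgebra of a $\ast_N$-algebra is an $N$-subalgebra $S$ that is $N$-self adjoint, i.e. $S^{\ast_N}:=\{x^{\ast_N}:x\in S\}=S$. *)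

(* Defs.v *)
From HB Require Import structures.
From mathcomp Require Import all_boot all_order all_algebra.
From mathcomp Require Import ring.
From mathcomp Require Import boolp classical_sets functions reals.

Set Implicit Arguments.
Unset Strict Implicit.
Unset Printing Implicit Defensive.

Import Order.TTheory GRing.Theory Num.Theory.

Local Open Scope classical_set_scope.
Local Open Scope ring_scope.

Notation generator R := {inj [set: R] >-> R}.

Section StarComplex.
Variables (R : realType) (alpha beta : generator R).

Definition CN_set : set (R * R) := range (fun p : R * R => (alpha p.1, beta p.2)).

Record CN := MkCN { CN_val : R * R ; CN_valP : CN_val \in CN_set }.

HB.instance Definition _ := [isSub for CN_val].
HB.instance Definition _ := [Choice of CN by <:].

Fact CN_of_subproof (a b : R) : (alpha a, beta b) \in CN_set.
Proof. by apply/mem_set; exists (a, b). Qed.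

Definition CN_of (a b : R) : CN := MkCN (CN_of_subproof a b).

(* The real numbers a and b such that z = (alpha a, beta b); they are unique by
   injectivity, and the default value 0 is never used (see CN_eta). *)
Definition CN_fst (z : CN) : R := 'pinv_(fun=> 0) [set: R] alpha (CN_val z).1.
Definition CN_snd (z : CN) : R := 'pinv_(fun=> 0) [set: R] beta (CN_val z).2.

Lemma CN_fstE a b : CN_fst (CN_of a b) = a.
Proof. by rewrite /CN_fst /= pinvKV ?inE//; exact: inj. Qed.

Lemma CN_sndE a b : CN_snd (CN_of a b) = b.
Proof. by rewrite /CN_snd /= pinvKV ?inE//; exact: inj. Qed.

Lemma CN_eta z : CN_of (CN_fst z) (CN_snd z) = z.
Proof.
have [[a b] _ zE] := set_mem (CN_valP z).
have -> : z = CN_of a b by apply/val_inj; rewrite /= -zE.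
by rewrite CN_fstE CN_sndE.
Qed.

Definition CN_zero := CN_of 0 0.
Definition CN_one := CN_of 1 0.
Definition CN_opp z := CN_of (- CN_fst z) (- CN_snd z).
Definition CN_add z w := CN_of (CN_fst z + CN_fst w) (CN_snd z + CN_snd w).
Definition CN_mul z w :=
  CN_of (CN_fst z * CN_fst w - CN_snd z * CN_snd w)
        (CN_fst z * CN_snd w + CN_snd z * CN_fst w).
Definition CN_inv z :=
  CN_of (CN_fst z / (CN_fst z ^+ 2 + CN_snd z ^+ 2))
        (- CN_snd z / (CN_fst z ^+ 2 + CN_snd z ^+ 2)).
Definition CN_conj z := CN_of (CN_fst z) (- CN_snd z).

Fact CN_addA : associative CN_add.
Proof. by move=> x y z; congr CN_of; rewrite !(CN_fstE, CN_sndE); ring. Qed.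
Fact CN_addC : commutative CN_add.
Proof. by move=> x y; congr CN_of; ring. Qed.
Fact CN_add0 : left_id CN_zero CN_add.
Proof. by move=> x; rewrite /CN_add CN_fstE CN_sndE !add0r CN_eta. Qed.
Fact CN_addN : left_inverse CN_zero CN_opp CN_add.
Proof. by move=> x; congr CN_of; rewrite !(CN_fstE, CN_sndE); ring. Qed.

HB.instance Definition _ :=
  GRing.isZmodule.Build CN CN_addA CN_addC CN_add0 CN_addN.

Fact CN_mulA : associative CN_mul.
Proof. by move=> x y z; congr CN_of; rewrite !(CN_fstE, CN_sndE); ring. Qed.
Fact CN_mulC : commutative CN_mul.
Proof. by move=> x y; congr CN_of; ring. Qed.
Fact CN_mul1 : left_id CN_one CN_mul.
Proof.
move=> x; rewrite /CN_mul CN_fstE CN_sndE.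
by rewrite !mul1r !mul0r subr0 addr0 CN_eta.
Qed.
Fact CN_mulDl : left_distributive CN_mul CN_add.
Proof. by move=> x y z; congr CN_of; rewrite !(CN_fstE, CN_sndE); ring. Qed.
Fact CN_one_neq0 : CN_one != CN_zero.
Proof.
apply/eqP => /(congr1 CN_fst); rewrite !CN_fstE.
by move/eqP; rewrite oner_eq0.
Qed.

HB.instance Definition _ := GRing.Zmodule_isComNzRing.Build CN
  CN_mulA CN_mulC CN_mul1 CN_mulDl CN_one_neq0.

Fact CN_mulV (z : CN) : z != 0 -> CN_inv z * z = 1.
Proof.
move=> z0; have n0 : CN_fst z ^+ 2 + CN_snd z ^+ 2 != 0.
  apply: contra z0; rewrite paddr_eq0 ?sqr_ge0// !sqrf_eq0.
  by move=> /andP[/eqP a0 /eqP b0]; rewrite -(CN_eta z) a0 b0.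
congr CN_of; rewrite !(CN_fstE, CN_sndE); last by field.
by field.
Qed.
Fact CN_inv0 : CN_inv 0 = 0.
Proof. by congr CN_of; rewrite !(CN_fstE, CN_sndE) ?oppr0 mul0r. Qed.

HB.instance Definition _ := GRing.ComNzRing_isField.Build CN CN_mulV CN_inv0.

Lemma CN_valE a b : CN_val (CN_of a b) = (alpha a, beta b).
Proof. by []. Qed.

Lemma CN_addE a1 b1 a2 b2 :
  CN_of a1 b1 + CN_of a2 b2 = CN_of (a1 + a2) (b1 + b2).
Proof. by congr CN_of; rewrite !(CN_fstE, CN_sndE). Qed.

Lemma CN_mulE a1 b1 a2 b2 :
  CN_of a1 b1 * CN_of a2 b2 = CN_of (a1 * a2 - b1 * b2) (a1 * b2 + b1 * a2).
Proof. by congr CN_of; rewrite !(CN_fstE, CN_sndE). Qed.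

Lemma CN_conjE a b : CN_conj (CN_of a b) = CN_of a (- b).
Proof. by congr CN_of; rewrite !(CN_fstE, CN_sndE). Qed.

End StarComplex.

(* C(N)-algebras are not required to have a unit, so they are not instances of
   the (unital) algebras algType of ssralg. *)
HB.mixin Record Lmodule_isCNAlgebra (R : realType) (alpha beta : generator R) A
    of GRing.Lmodule (CN alpha beta) A := {
  nmul : A -> A -> A;
  nmulA : associative nmul;
  nmulDl : left_distributive nmul +%R;
  nmulDr : right_distributive nmul +%R;
  nscaleAr : forall (l : CN alpha beta) (x y : A),
    l *: nmul x y = nmul x (l *: y);
  nscaleAl : forall (l : CN alpha beta) (x y : A),
    l *: nmul x y = nmul (l *: x) y
}.

#[short(type="cnAlgType")]
HB.structure Definition CNAlgebra (R : realType) (alpha beta : generator R) :=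
  { A of GRing.Lmodule (CN alpha beta) A & Lmodule_isCNAlgebra R alpha beta A }.

HB.mixin Record CNAlgebra_hasInvolution
    (R : realType) (alpha beta : generator R) A of CNAlgebra R alpha beta A := {
  nstar : A -> A;
  nstarD : forall x y : A, nstar (x + y) = nstar x + nstar y;
  nstarZ : forall (l : CN alpha beta) (x : A),
    nstar (l *: x) = CN_conj l *: nstar x;
  nstarM : forall x y : A, nstar (nmul x y) = nmul (nstar y) (nstar x);
  nstarK : involutive nstar
}.

#[short(type="starAlgType")]
HB.structure Definition StarAlgebra (R : realType) (alpha beta : generator R) :=
  { A of CNAlgebra R alpha beta A & CNAlgebra_hasInvolution R alpha beta A }.

Definition CN_alg_hom (R : realType) (alpha beta : generator R)
    (A B : cnAlgType alpha beta) (phi : A -> B) : Prop :=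
  linear phi /\ (forall x y : A, phi (nmul x y) = nmul (phi x) (phi y)).

Definition star_hom (R : realType) (alpha beta : generator R)
    (A B : starAlgType alpha beta) (phi : A -> B) : Prop :=
  CN_alg_hom phi /\ (forall x : A, phi (nstar x) = nstar (phi x)).

Definition N_subalgebra (R : realType) (alpha beta : generator R)
    (A : cnAlgType alpha beta) (S : set A) : Prop :=
  [/\ S 0,
      forall x y : A, S x -> S y -> S (x + y),
      forall (l : CN alpha beta) (x : A), S x -> S (l *: x)
    & forall x y : A, S x -> S y -> S (nmul x y)].

Definition N_self_adjoint (R : realType) (alpha beta : generator R)
    (A : starAlgType alpha beta) (S : set A) : Prop :=
  [set nstar x | x in S] = S.

Definition star_subalgebra (R : realType) (alpha beta : generator R)
    (A : starAlgType alpha beta) (S : set A) : Prop :=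
  N_subalgebra S /\ N_self_adjoint S.

(* Main.v *)
Require Import Defs.
From mathcomp Require Import all_boot all_order all_algebra.
From mathcomp Require Import boolp classical_sets functions reals.

Import GRing.Theory.

Local Open Scope classical_set_scope.
Local Open Scope ring_scope.

(** Since [phi] commutes with every operation, an operation on values of [phi] can be carried out on
    preimages. This makes the image stable under [nstar]; involutivity turns that inclusion into
    equality. *)

Theorem theorem9 (R : realType) (alpha beta : generator R)
    (A B : starAlgType alpha beta) (phi : A -> B) :
  star_hom phi -> star_subalgebra (phi @` [set: A]).
Proof.
move=> [[philin phiM] phiS].
have phi0 : phi 0 = 0.
  (* The scalar -1 makes linearity read [phi 0 = - phi 0 + phi 0]. *)
  by have := philin (-1) 0 0; rewrite scaler0 addr0 scaleN1r addNr.
split; first split.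
- by exists 0.
- move=> _ _ [x _ <-] [y _ <-]; exists (x + y) => //.
  by have := philin 1 x y; rewrite !scale1r.
- move=> l _ [x _ <-]; exists (l *: x) => //.
  by have := philin l x 0; rewrite phi0 !addr0.
- by move=> _ _ [x _ <-] [y _ <-]; exists (nmul x y).
apply/seteqP; split => [_ [_ [x _ <-] <-]|_ [x _ <-]].
  by exists (nstar x).
(* Reverse inclusion: [phi x] is the star of [phi (nstar x)], as [nstar] is its own inverse. *)
exists (phi (nstar x)); first by exists (nstar x).
by rewrite phiS nstarK.
Qed.
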